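(* Let $m,n\in\mathbb N_0$, let $q\in\mathbb C$ with $q\ne0$, $|q|\neq1$, and let $\alpha,\beta\in\mathbb C$, such that no denominator below vanishes. Put $x_m^{\pm}:=\pm\tfrac12(q^{\frac14+\frac m2}+q^{-\frac14-\frac m2})$. Then, with the upper signs taken throughout or the lower signs taken throughout, $$P_n^{(\alpha,\beta)}(x_m^{\pm}|q)=\frac{\left(\pm q^{\frac\alpha2+\frac14}\right)^n}{(q^{\frac12},-q^{\frac12},-q^{\frac{\alpha+\beta+1}{2}};q^{\frac12})_n}\;p_n\left(x_m^{+};q^{\frac14},-q^{\frac14},\pm q^{\frac\alpha2+\frac14},\mp q^{\frac\beta2+\frac14}\big|q^{\frac12}\right)$$ $$=\frac{\left(\pm q^{\frac\alpha2}\right)^n\left(q^{\frac{\alpha+\beta+1}{4}}\right)^m(\pm q^{\frac{\alpha+1}{2}},\mp q^{\frac{\beta+1}{2}};q^{\frac12})_n}{(q^{\frac12},-q^{\frac{\alpha+\beta+1}{2}};q^{\frac12})_n\,(-q^{\frac12},\pm q^{\frac{\alpha+1}{2}},\mp q^{\frac{\beta+1}{2}};q^{\frac12})_m}$$ $$\qquad\times p_m\left(\tfrac12(q^{\frac{\alpha+\beta+1+2n}{4}}+q^{-\frac{\alpha+\beta+1+2n}{4}});q^{\frac{\alpha+\beta+1}{4}},-q^{\frac{-\alpha-\beta+1}{4}},\pm q^{\frac{\alpha-\beta+1}{4}},\mp q^{\frac{\beta-\alpha+1}{4}}\big|q^{\frac12}\right).$$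
   Context: Complex powers of $q$: fix a logarithm $\log q$ and set $q^s:=\exp(s\log q)$. Notation: $(a;q)_n:=\prod_{k=0}^{n-1}(1-aq^k)$, and $(a_1,\dots,a_r;q)_n:=\prod_i (a_i;q)_n$; in this notation $\pm a$ in the statement denotes a single entry whose sign is the chosen one. Askey--Wilson polynomials: for $x=\frac12(z+z^{-1})$, $z\in\mathbb C\setminus\{0\}$, $$p_n(x;a,b,c,d|q):=a^{-n}(ab,ac,ad;q)_n\sum_{k=0}^n\frac{(q^{-n},q^{n-1}abcd,az,az^{-1};q)_k}{(q,ab,ac,ad;q)_k}q^k,$$ where $(ab;q)_n/(ab;q)_k$ is read as $(abq^k;q)_{n-k}$ (likewise for $ac$, $ad$), so that $p_n$ is always defined. The notation $p_n(\cdot|q^{1/2})$ means that the base $q$ is replaced by $q^{1/2}$ in this definition. Continuous $q$-Jacobi polynomials: $$P_n^{(\alpha,\beta)}(x|q):=\frac{q^{(\frac{\alpha}{2}+\frac14)n}}{(q,-q^{\frac{\alpha+\beta+1}{2}},-q^{\frac{\alpha+\beta+2}{2}};q)_n}\,p_n\left(x;q^{\frac{\alpha}{2}+\frac14},q^{\frac{\alpha}{2}+\frac34},-q^{\frac{\beta}{2}+\frac14},-q^{\frac{\beta}{2}+\frac34}\big|q\right).$$ *)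

(* Defs.v *)
From HB Require Import structures.
From mathcomp Require Export all_boot all_order all_algebra.
From mathcomp Require Export complex.
From mathcomp Require Export reals sequences exp trigo.
From mathcomp Require Import ring.

Set Implicit Arguments.
Unset Strict Implicit.
Unset Printing Implicit Defensive.

Import Order.TTheory GRing.Theory Num.Theory.

Local Open Scope ring_scope.
Local Open Scope complex_scope.

Definition cexp (R : realType) (z : R[i]) : R[i] :=
  (expR (complex.Re z) * cos (complex.Im z)) +i*
  (expR (complex.Re z) * sin (complex.Im z)).

(* The complex power q^s attached to a logarithm logq of q. *)
Definition cpow (R : realType) (logq s : R[i]) : R[i] := cexp (s * logq).

Definition qpoch (F : fieldType) (a q : F) (n : nat) : F :=
  \prod_(k < n) (1 - a * q ^+ k).

Definition qpochs (F : fieldType) (s : seq F) (q : F) (n : nat) : F :=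
  \prod_(a <- s) qpoch a q n.

(* The Askey-Wilson polynomial in the variable z, where x = (z + 1/z) / 2;
   the quotients (ab;q)_n / (ab;q)_k are written (ab q^k;q)_(n-k). *)
Definition askey_wilson_z (F : fieldType) (n : nat) (z a b c d q : F) : F :=
  a ^- n *
  \sum_(k < n.+1)
    qpochs [:: q ^- n; q ^ (n%:Z - 1) * (a * b * c * d); a * z; a * z^-1] q k
    / qpoch q q k
    * qpochs [:: a * b * q ^+ k; a * c * q ^+ k; a * d * q ^+ k] q (n - k)
    * q ^+ k.

(* A solution z of x = (z + 1/z) / 2; the other one is its inverse, and
   askey_wilson_z takes the same value at both (see askey_wilsonE). *)
Definition joukowsky_inv (F : numClosedFieldType) (x : F) : F :=
  x + sqrtC (x ^+ 2 - 1).

Definition askey_wilson (F : numClosedFieldType) (n : nat)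
    (x a b c d q : F) : F :=
  askey_wilson_z n (joukowsky_inv x) a b c d q.

Lemma askey_wilson_zV (F : fieldType) (n : nat) (z a b c d q : F) :
  askey_wilson_z n z^-1 a b c d q = askey_wilson_z n z a b c d q.
Proof.
rewrite /askey_wilson_z; congr (_ * _); apply: eq_bigr => k _.
rewrite invrK; congr (_ / _ * _ * _).
by rewrite /qpochs !big_cons !big_nil !mulr1 [X in _ * (_ * X)]mulrC.
Qed.

Lemma joukowsky_inv_correct (F : numClosedFieldType) (z : F) : z != 0 ->
  joukowsky_inv ((z + z^-1) / 2) = z \/
  joukowsky_inv ((z + z^-1) / 2) = z^-1.
Proof.
move=> z0; rewrite /joukowsky_inv.
set x := (z + z^-1) / 2; set w := (z - z^-1) / 2.
have n2 : 2 != 0 :> F by rewrite pnatr_eq0.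
have -> : x ^+ 2 - 1 = w ^+ 2 by rewrite /x /w; field; rewrite ?z0 ?n2.
have /eqP := sqrtCK (w ^+ 2); rewrite eqf_sqr => /orP[] /eqP ->.
  by left; rewrite /x /w; field; rewrite ?z0 ?n2.
by right; rewrite /x /w; field; rewrite ?z0 ?n2.
Qed.

Lemma askey_wilsonE (F : numClosedFieldType) (n : nat) (z a b c d q : F) :
  z != 0 ->
  askey_wilson n ((z + z^-1) / 2) a b c d q = askey_wilson_z n z a b c d q.
Proof.
move=> z0; rewrite /askey_wilson.
by case: (joukowsky_inv_correct z0) => ->; rewrite ?askey_wilson_zV.
Qed.

(* Denominator in the definition of the continuous q-Jacobi polynomials. *)
Definition q_jacobi_den (R : realType) (n : nat) (alpha beta q logq : R[i]) :
    R[i] :=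
  qpochs [:: q; - cpow logq ((alpha + beta + 1) / 2);
             - cpow logq ((alpha + beta + 2) / 2)] q n.

Definition q_jacobi (R : realType) (n : nat) (alpha beta x q logq : R[i]) :
    R[i] :=
  cpow logq ((alpha / 2 + 1 / 4) * n%:R)
  / q_jacobi_den n alpha beta q logq
  * askey_wilson n x
      (cpow logq (alpha / 2 + 1 / 4))
      (cpow logq (alpha / 2 + 3 / 4))
      (- cpow logq (beta / 2 + 1 / 4))
      (- cpow logq (beta / 2 + 3 / 4))
      q.

(* Main.v *)
(* Put p = q^(1/2), h = q^(1/4), A = q^(alpha/2+1/4), B = q^(beta/2+1/4).
   The first equality is the quadratic transformation
     p_n(x; A, Ap, -B, -Bp | p^2) = (-AB p^n; p)_n p_n(x; h, -h, A, -B | p),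
   valid for all x; the lower signs follow from the upper ones on replacing h
   by -h and x by -x.  For the parameters h, -h, A, -B the Askey-Wilson
   difference operator in base p is, up to a constant, the operator
     E f(z) = e(z) f(pz) + e(1/z) f(z/p),  e(z) = (1-Az)(1+Bz)/(1-z^2),
   and E^2 is, up to a constant, the Askey-Wilson operator in base p^2 for
   A, Ap, -B, -Bp.  Hence both sides are eigenfunctions of the latter for the
   same eigenvalue; when the eigenvalues are distinct, a polynomial
   eigenfunction is determined by its leading coefficient.  As both sides are
   polynomial in B, the restriction on the eigenvalues can be dropped.
   The second equality is the exchange of m and n in the terminating series,
   whose argument z = h p^m makes it stop at min(m, n). *)
Require Import Defs.
From mathcomp Require Import ring zify.
Import Order.TTheory GRing.Theory Num.Theory.
Local Open Scope ring_scope.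
Local Open Scope complex_scope.

(** * Shifted factorials and powers of a base that is not a root of unity *)

Section QPoch.
Set Implicit Arguments.
Unset Strict Implicit.
Variables (F : fieldType) (q : F).
Implicit Types a : F.

Lemma qpoch0 a : qpoch a q 0 = 1.
Proof. by rewrite /qpoch big_ord0. Qed.

Lemma qpochSr a n : qpoch a q n.+1 = qpoch a q n * (1 - a * q ^+ n).
Proof. by rewrite /qpoch big_ord_recr. Qed.

Lemma qpochD a m n : qpoch a q (m + n) = qpoch a q m * qpoch (a * q ^+ m) q n.
Proof.
rewrite /qpoch big_split_ord; congr (_ * _); apply: eq_bigr => i _ /=.
by rewrite exprD mulrA.
Qed.

Lemma qpochSl a n : qpoch a q n.+1 = (1 - a) * qpoch (a * q) q n.
Proof. by rewrite -add1n qpochD qpochSr qpoch0 expr0 expr1 mul1r mulr1. Qed.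

Lemma qpochs_cons a s n : qpochs (a :: s) q n = qpoch a q n * qpochs s q n.
Proof. by rewrite /qpochs big_cons. Qed.

Lemma qpochs_nil n : qpochs [::] q n = 1.
Proof. by rewrite /qpochs big_nil. Qed.

Definition qpochsE := (qpochs_cons, qpochs_nil, mulr1).

Lemma qpochVX_eq0 n k : q != 0 -> (n < k)%N -> qpoch (q ^- n) q k = 0.
Proof.
move=> q0 nk; apply/eqP; apply/prodf_eq0; exists (Ordinal nk) => //=.
by rewrite mulVf ?expf_neq0// subrr.
Qed.

Hypothesis q0 : q != 0.
Hypothesis q_nroot : forall k, q ^+ k.+1 != 1.

Lemma qpochqq_neq0 n : qpoch q q n != 0.
Proof.
apply/prodf_neq0 => i _; rewrite -exprS subr_eq0 eq_sym; exact: q_nroot.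
Qed.

Lemma exprX_inj : injective (fun i => q ^+ i).
Proof.
suff H i j : (i < j)%N -> q ^+ i != q ^+ j.
  move=> i j eqij; case: (ltngtP i j) => // /H; by rewrite eqij eqxx.
move=> /subnKC <-; rewrite addSnnS exprD -{1}[q ^+ i]mulr1.
by rewrite (inj_eq (mulfI _)) ?expf_neq0// eq_sym q_nroot.
Qed.

End QPoch.

Lemma qpoch_sqr (F : fieldType) (a q : F) n :
  qpoch (a ^+ 2) (q ^+ 2) n = qpoch a q n * qpoch (- a) q n.
Proof.
rewrite /qpoch -big_split; apply: eq_bigr => i _ /=.
by rewrite -exprM mulnC exprM; ring.
Qed.

Lemma qpoch_double (F : fieldType) (a q : F) n :
  qpoch a q (n + n) = qpoch a (q ^+ 2) n * qpoch (a * q) (q ^+ 2) n.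
Proof.
elim: n => [|n IH]; first by rewrite !qpoch0 mulr1.
rewrite addSn addnS !qpochSr IH -!exprM mul2n -addnn (exprS q (n + n)); ring.
Qed.

(** * The symmetric basis $(az,a/z;q)_k$ *)

Section Base.
Set Implicit Arguments.
Unset Strict Implicit.
Variables (F : fieldType) (a q : F).
Hypothesis q0 : q != 0.

Definition aw_base k (z : F) := qpoch (a * z) q k * qpoch (a * z^-1) q k.

Lemma aw_baseV k z : aw_base k z^-1 = aw_base k z.
Proof. by rewrite /aw_base invrK mulrC. Qed.

Lemma aw_baseS k z : aw_base k.+1 z =
  aw_base k z * ((1 - a * q ^+ k * z) * (1 - a * q ^+ k / z)).
Proof. rewrite /aw_base !qpochSr. ring. Qed.

(** The factor [1 - a * z], supplied by the operator coefficient [awC], completes $(aqz;q)_{k+1}$ to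
    $(az;q)_{k+2}$, while $(a/(qz);q)_{k+1}$ sheds its first factor. So [aw_base k z] splits off
    without division by [1 - a * z]. *)
Lemma aw_base_shift k z : z != 0 -> (1 - a * z) * aw_base k.+1 (q * z) =
  aw_base k z * ((1 - a * q ^+ k * z) * (1 - a * q ^+ k.+1 * z) *
                 (1 - a / (q * z))).
Proof.
move=> z0; rewrite /aw_base [qpoch (a * (q * z)^-1) _ _]qpochSl.
have -> : a * (q * z)^-1 * q = a * z^-1 by field; rewrite z0 q0.
have := qpochSl q (a * z) k.+1.
rewrite (_ : a * z * q = a * (q * z)); last by ring.
rewrite !(qpochSr q (a * z)) => E.
transitivity ((1 - a * z) * qpoch (a * (q * z)) q k.+1 *
              ((1 - a / (q * z)) * qpoch (a * z^-1) q k)); first by ring.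
rewrite -E; ring.
Qed.

Lemma aw_base_shiftV k z : z != 0 -> (1 - a / z) * aw_base k.+1 (z / q) =
  aw_base k z * ((1 - a * q ^+ k / z) * (1 - a * q ^+ k.+1 / z) *
                 (1 - a * (z / q))).
Proof.
move=> z0; have zV0 : z^-1 != 0 by rewrite invr_eq0.
have := aw_base_shift k zV0.
have -> : q * z^-1 = (z / q)^-1 by field; rewrite z0 q0.
by rewrite !aw_baseV invrK.
Qed.

(** The variable ['X] stands for $z+z^{-1}=2x$, so that each factor is $(1-aq^iz)(1-aq^i/z)$ and no
    halves appear. *)
Definition aw_basep k : {poly F} :=
  \prod_(i < k) ((1 + (a * q ^+ i) ^+ 2)%:P - (a * q ^+ i) *: 'X).

Lemma horner_aw_basep k z : z != 0 -> (aw_basep k).[z + z^-1] = aw_base k z.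
Proof.
move=> z0; rewrite /aw_basep /aw_base /qpoch -big_split /= horner_prod.
by apply: eq_bigr => i _; rewrite !hornerE; field.
Qed.

Lemma size_aw_basep k : (size (aw_basep k) <= k.+1)%N.
Proof.
elim: k => [|k IH]; first by rewrite /aw_basep big_ord0 size_poly1.
rewrite /aw_basep big_ord_recr /= -/(aw_basep k).
apply: leq_trans (size_polyMleq _ _) _.
set u := (_ - _); have H : (size u <= 2)%N.
  apply: leq_trans (size_polyD _ _) _; rewrite geq_max size_polyN.
  apply/andP; split.
    exact: leq_trans (size_polyC_leq1 _) _.
  by apply: leq_trans (size_scale_leq _ _) _; rewrite size_polyX.
by rewrite -subn1 leq_subLR; apply: leq_trans (leq_add IH H) _; rewrite addnC.
Qed.

Lemma coef_aw_basep k : (aw_basep k)`_k = \prod_(i < k) (- (a * q ^+ i)).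
Proof.
elim: k => [|k IH]; first by rewrite /aw_basep !big_ord0 coef1.
rewrite /aw_basep !big_ord_recr /= -/(aw_basep k) mulrBr coefB.
rewrite [_ * _%:P]mulrC coefCM nth_default ?size_aw_basep// mulr0 sub0r.
by rewrite -scalerAr coefZ coefMX /= IH mulrN mulrC.
Qed.

End Base.

(** * The Askey-Wilson operator on the symmetric basis *)

Section Operator.
Set Implicit Arguments.
Unset Strict Implicit.
Variables (F : fieldType) (a b c d q : F).
Hypothesis q0 : q != 0.

Definition awC (z : F) :=
  (1 - a * z) * (1 - b * z) * (1 - c * z) * (1 - d * z) /
  ((1 - z ^+ 2) * (1 - q * z ^+ 2)).

(** The Askey-Wilson $q$-difference operator, acting on functions of $z$ instead of $x$. On the
    basis [aw_base] it is bidiagonal, with diagonal entries [aw_eig] and off-diagonal entries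
    [aw_low]. *)
Definition awD (f : F -> F) (z : F) :=
  awC z * (f (q * z) - f z) + awC z^-1 * (f (z / q) - f z).

Definition aw_eig k := (q ^- k - 1) * (1 - a * b * c * d * q ^+ k / q).

Definition aw_low k := - q ^- k * (1 - q ^+ k) *
  (1 - a * b * q ^+ k / q) * (1 - a * c * q ^+ k / q) *
  (1 - a * d * q ^+ k / q).

(** These are the points where the denominators of both [awC z] and [awC z^-1] are nonzero. *)
Definition aw_generic (z : F) :=
  [&& z != 0, z ^+ 2 != 1, q * z ^+ 2 != 1 & z ^+ 2 != q].

Lemma awD_base k z : aw_generic z ->
  awD (aw_base a q k) z =
  aw_eig k * aw_base a q k z + aw_low k * aw_base a q k.-1 z.
Proof.
case/and4P => z0 z1 z2 z3.
(* For [k = 0] the index [k.-1] is again 0, but [aw_low] vanishes there. *)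
case: k => [|k].
  by rewrite /awD /aw_base /aw_eig /aw_low !qpoch0 expr0 invr1 !subrr; ring.
(* Both halves of the operator are brought to a multiple of [aw_base a q k z]; after that the claim
   is an identity of rational functions in [z] and [q ^+ k]. *)
have C1 : awC z * (aw_base a q k.+1 (q * z) - aw_base a q k.+1 z) =
  (1 - b * z) * (1 - c * z) * (1 - d * z) /
    ((1 - z ^+ 2) * (1 - q * z ^+ 2)) *
  (aw_base a q k z * (1 - a * q ^+ k * z) *
   ((1 - a * q ^+ k.+1 * z) * (1 - a / (q * z))
    - (1 - a * z) * (1 - a * q ^+ k / z))).
  have E := aw_base_shift a q0 k z0.
  rewrite /awC; transitivity ((1 - b * z) * (1 - c * z) * (1 - d * z) /
    ((1 - z ^+ 2) * (1 - q * z ^+ 2)) *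
    ((1 - a * z) * aw_base a q k.+1 (q * z)
     - (1 - a * z) * aw_base a q k.+1 z)); first by ring.
  rewrite E aw_baseS; congr (_ * _); ring.
have C2 : awC z^-1 * (aw_base a q k.+1 (z / q) - aw_base a q k.+1 z) =
  (1 - b / z) * (1 - c / z) * (1 - d / z) /
    ((1 - z^-1 ^+ 2) * (1 - q * z^-1 ^+ 2)) *
  (aw_base a q k z * (1 - a * q ^+ k / z) *
   ((1 - a * q ^+ k.+1 / z) * (1 - a * (z / q))
    - (1 - a / z) * (1 - a * q ^+ k * z))).
  have E := aw_base_shiftV a q0 k z0.
  rewrite /awC; transitivity ((1 - b / z) * (1 - c / z) * (1 - d / z) /
    ((1 - z^-1 ^+ 2) * (1 - q * z^-1 ^+ 2)) *
    ((1 - a / z) * aw_base a q k.+1 (z / q)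
     - (1 - a / z) * aw_base a q k.+1 z)); first by ring.
  rewrite E aw_baseS; congr (_ * _); ring.
rewrite /awD C1 C2 aw_baseS /= /aw_eig /aw_low !(exprS q k).
have := expf_neq0 k q0; move: (q ^+ k) (aw_base a q k z) => t w t0.
rewrite (_ : (1 - z^-1 ^+ 2) = - (1 - z ^+ 2) / z ^+ 2); last by field.
rewrite (_ : (1 - q * z^-1 ^+ 2) = - (q - z ^+ 2) / z ^+ 2); last by field.
field.
by rewrite !oppr_eq0 !subr_eq0 t0 q0 z0 !(eq_sym _ (z ^+ 2)) z3
  !(eq_sym 1) z1 z2.
Qed.
End Operator.

(** * Eigenfunctions: existence, leading coefficients, uniqueness *)

Section OperatorTheory.
Set Implicit Arguments.
Unset Strict Implicit.
Variables (F : fieldType) (a b c d q : F).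
Hypothesis q0 : q != 0.

Local Notation D := (awD a b c d q).

Lemma awD_sum (I : Type) (r : seq I) (e : I -> F) (f : I -> F -> F) z :
  D (fun w => \sum_(i <- r) e i * f i w) z = \sum_(i <- r) e i * D (f i) z.
Proof.
rewrite /awD -!sumrB !mulr_sumr -big_split /=.
by apply: eq_bigr => i _; ring.
Qed.

Lemma eq_awD f g z : z != 0 -> (forall w, w != 0 -> f w = g w) ->
  D f z = D g z.
Proof. by move=> z0 E; rewrite /awD !E ?mulf_neq0 ?invr_eq0. Qed.

Lemma aw_eigB k n : aw_eig a b c d q k - aw_eig a b c d q n =
  (q ^- k - q ^- n) * (1 - a * b * c * d * q ^+ k * q ^+ n / q).
Proof.
rewrite /aw_eig; have := expf_neq0 k q0; have := expf_neq0 n q0.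
move: (q ^+ k) (q ^+ n) => x y y0 x0; field; by rewrite x0 y0 q0.
Qed.

Definition aw_coef n k := a ^- n *
  (qpoch (q ^- n) q k * qpoch (q ^ (n%:Z - 1) * (a * b * c * d)) q k
   / qpoch q q k
   * (qpoch (a * b * q ^+ k) q (n - k) * qpoch (a * c * q ^+ k) q (n - k)
      * qpoch (a * d * q ^+ k) q (n - k)) * q ^+ k).

Lemma askey_wilson_zE n z : askey_wilson_z n z a b c d q =
  \sum_(k < n.+1) aw_coef n k * aw_base a q k z.
Proof.
rewrite /askey_wilson_z mulr_sumr; apply: eq_bigr => k _.
by rewrite /aw_coef !qpochsE /aw_base; ring.
Qed.

Lemma exprz_subr1 n : q ^ (n%:Z - 1) = q ^+ n / q.
Proof. by rewrite expfzDr// -exprnP exprN1. Qed.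

Section NotRootOfUnity.
Hypothesis q_nroot : forall k, q ^+ k.+1 != 1.

(** This is the vanishing of the coefficient of [aw_base a q k] in $(D-\lambda_n)p_n$, where
    $\lambda_n$ is [aw_eig] at [n]. *)
Lemma aw_coef_rec n k : (k <= n)%N ->
  aw_coef n k * (aw_eig a b c d q k - aw_eig a b c d q n) +
  aw_coef n k.+1 * aw_low a b c d q k.+1 = 0.
Proof.
rewrite leq_eqVlt => /predU1P[-> | kn].
  by rewrite subrr mulr0 add0r /aw_coef qpochVX_eq0// !mul0r mulr0 mul0r.
rewrite aw_eigB /aw_coef /aw_low -[(n - k)%N](@prednK) ?subn_gt0// -subnS.
rewrite ![qpoch (_ * _ * q ^+ k) q _.+1]qpochSl -!(mulrA _ (q ^+ k) q).
rewrite -!exprSr !qpochSr exprz_subr1.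
have nr := q_nroot k.
have Q0 := qpochqq_neq0 q_nroot k.
have := expf_neq0 k q0; have := expf_neq0 n q0.
have := nr; rewrite !(exprS q k).
move: (q ^+ k) (q ^+ n) (a ^- n) Q0 => x y A' Q0 nx y0 x0.
field.
by rewrite Q0 q0 x0 y0 subr_eq0 eq_sym nx.
Qed.

Lemma aw_diffeq n z : aw_generic q z ->
  D (fun w => askey_wilson_z n w a b c d q) z =
  aw_eig a b c d q n * askey_wilson_z n z a b c d q.
Proof.
move=> gz; have z0 : z != 0 by case/and4P: gz.
rewrite (@eq_awD _ _ z z0 (fun w _ => askey_wilson_zE n w)) awD_sum.
rewrite askey_wilson_zE; apply/eqP; rewrite -subr_eq0 mulr_sumr -sumrB.
(* By the recurrence the [k]-th summand of $(D-\lambda_n)p_n$ is [T k.+1 - T k]. The sum telescopes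
   to zero: [T 0] contains [aw_low] at 0, and [T n.+1] contains $(q^{-n};q)_{n+1}$. *)
pose T k := - (aw_coef n k * aw_low a b c d q k * aw_base a q k.-1 z).
rewrite -(big_mkord xpredT (fun k => aw_coef n k * D (aw_base a q k) z
  - aw_eig a b c d q n * (aw_coef n k * aw_base a q k z))).
rewrite (telescope_sumr_eq T)//; last first.
  move=> k /andP[_ kn]; rewrite awD_base// /T /=.
  have /eqP := @aw_coef_rec n k kn.
  rewrite addrC addr_eq0 => /eqP ->; ring.
rewrite /T /aw_low expr0 subrr mulr0 !mul0r !mulr0 mul0r oppr0 subr0 oppr_eq0.
by rewrite /aw_coef qpochVX_eq0// !mul0r mulr0 !mul0r.
Qed.

Definition aw_poly n : {poly F} :=
  \sum_(k < n.+1) aw_coef n k *: aw_basep a q k.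

Lemma horner_aw_poly n z : z != 0 ->
  (aw_poly n).[z + z^-1] = askey_wilson_z n z a b c d q.
Proof.
move=> z0; rewrite askey_wilson_zE horner_sum; apply: eq_bigr => k _.
by rewrite hornerZ horner_aw_basep.
Qed.

Lemma size_aw_poly n : (size (aw_poly n) <= n.+1)%N.
Proof.
apply: leq_trans (size_sum _ _ _) _; apply/bigmax_leqP => k _.
apply: leq_trans (size_scale_leq _ _) _.
by apply: leq_trans (size_aw_basep _ _ _) _.
Qed.

Lemma qpochVX n : qpoch (q ^- n) q n * q ^+ n * \prod_(i < n) (- (q ^+ i)) =
  qpoch q q n.
Proof.
elim: n => [|n IH]; first by rewrite !qpoch0 big_ord0 expr0 !mulr1.
rewrite qpochSl big_ord_recr /= [in RHS]qpochSr -IH exprS.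
have -> : (q * q ^+ n)^-1 * q = q ^- n by field; rewrite q0 expf_neq0.
have := expf_neq0 n q0; move: (q ^+ n) => x x0; field; by rewrite q0 x0.
Qed.

(** Only the summand [k = n] reaches degree [n]. Its $a^{-n}$ cancels against the leading
    coefficient of the basis element, and [qpochVX] cancels $(q;q)_n$. *)
Lemma lead_aw_poly n : a != 0 ->
  (aw_poly n)`_n = qpoch (a * b * c * d * q ^+ n / q) q n.
Proof.
move=> a0; rewrite /aw_poly coef_sum big_ord_recr /= big1 ?add0r; last first.
  move=> k _; rewrite coefZ nth_default ?mulr0//.
  by apply: leq_trans (size_aw_basep _ _ _) _.
rewrite coefZ coef_aw_basep /aw_coef subnn !qpoch0 exprz_subr1.
have -> : \prod_(i < n) - (a * q ^+ i) = a ^+ n * \prod_(i < n) (- (q ^+ i)).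
  rewrite -[X in a ^+ X](card_ord n) -prodr_const.
  by rewrite -big_split; apply: eq_bigr => i _; rewrite /= mulrN.
have E := qpochVX n; have Q0 := qpochqq_neq0 q_nroot n.
have a0n := expf_neq0 n a0.
transitivity (qpoch (q ^+ n / q * (a * b * c * d)) q n *
  (qpoch (q ^- n) q n * q ^+ n * \prod_(i < n) - q ^+ i) / qpoch q q n).
  field; by rewrite a0n Q0.
rewrite E mulfK//; congr qpoch; ring.
Qed.

End NotRootOfUnity.

(** The operator is triangular with respect to degree in $z+z^{-1}$. The induction peels off the
    multiple of the top basis element that carries the leading coefficient; [awD_base] treats that
    part. *)
Lemma awD_poly (a0 : a != 0) N (r : {poly F}) : (size r <= N)%N ->
  exists s : {poly F}, [/\ (size s <= N)%N,
    s`_N.-1 = aw_eig a b c d q N.-1 * r`_N.-1 &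
    forall z, aw_generic q z ->
      D (fun w => r.[w + w^-1]) z = s.[z + z^-1]].
Proof.
elim: N r => [|N IH] r.
  rewrite size_poly_leq0 => /eqP ->; exists 0; split; rewrite ?size_poly0//=.
    by rewrite coef0 mulr0.
  by move=> z _; rewrite /awD !horner0 subrr !mulr0 addr0.
move=> sr; pose t := (aw_basep a q N)`_N.
have t0 : t != 0.
  rewrite /t coef_aw_basep; apply/prodf_neq0 => i _.
  by rewrite oppr_eq0 mulf_neq0 ?expf_neq0.
pose e := r`_N / t; pose r' := r - e *: aw_basep a q N.
have sr' : (size r' <= N)%N.
  apply/leq_sizeP => j; rewrite leq_eqVlt => /predU1P[<- | Nj].
    by rewrite /r' coefB coefZ -/t /e mulfVK// subrr.
  rewrite /r' coefB coefZ !nth_default ?mulr0 ?subrr//.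
    exact: leq_trans (size_aw_basep _ _ _) _.
  exact: leq_trans sr _.
have [s' [ss' _ Es']] := IH _ sr'.
exists (e *: (aw_eig a b c d q N *: aw_basep a q N +
              aw_low a b c d q N *: aw_basep a q N.-1) + s').
have low : (aw_low a b c d q N *: aw_basep a q N.-1)`_N = 0.
  case: (N) => [|M]; first by rewrite coefZ /aw_low expr0 subrr mulr0 !mul0r.
  by rewrite coefZ nth_default ?mulr0// size_aw_basep.
split.
- apply: leq_trans (size_polyD _ _) _; rewrite geq_max (leq_trans ss')//.
  rewrite andbT; apply: leq_trans (size_scale_leq _ _) _.
  apply: leq_trans (size_polyD _ _) _; rewrite geq_max; apply/andP; split.
    by apply: leq_trans (size_scale_leq _ _) _; rewrite size_aw_basep.
  apply: leq_trans (size_scale_leq _ _) _.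
  by apply: leq_trans (size_aw_basep _ _ _) _; rewrite ltnS leq_pred.
- rewrite /= coefD coefZ coefD low [s'`_N]nth_default// coefZ -/t addr0 addr0.
  by rewrite mulrCA /e mulfVK.
- move=> z gz; have z0 : z != 0 by case/and4P: gz.
  rewrite hornerD -Es'// hornerZ hornerD !hornerZ !horner_aw_basep//.
  rewrite -awD_base//.
  have -> : r = r' + e *: aw_basep a q N by rewrite subrK.
  rewrite /awD !hornerD !hornerZ.
  by rewrite !horner_aw_basep ?mulf_neq0 ?invr_eq0//; ring.
Qed.

Lemma poly_eq0_inj (r : {poly F}) (x : nat -> F) : injective x ->
  (forall i, r.[x i] = 0) -> r = 0.
Proof.
move=> xI rx; apply/eqP/negPn/negP => r0.
have := @max_poly_roots _ _ (map x (iota 0 (size r))) r0.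
rewrite map_inj_uniq// iota_uniq size_map size_iota ltnn => H.
suff: false by []; apply: H => //.
by apply/allP => _ /mapP[i _ ->]; apply/rootP.
Qed.

(** A nonzero [r] would have some degree $d<n$. Triangularity multiplies its leading coefficient by
    the eigenvalue of index $d$, the equation by that of index [n], and these differ. Agreement at
    the infinitely many values given by [zs] makes the equation an identity of polynomials. *)
Lemma awD_eigen_unique (a0 : a != 0) (zs : nat -> F) n (r : {poly F}) :
  (forall i, aw_generic q (zs i)) -> injective (fun i => zs i + (zs i)^-1) ->
  (forall k, (k < n)%N -> aw_eig a b c d q k != aw_eig a b c d q n) ->
  (size r <= n)%N ->
  (forall i, D (fun w => r.[w + w^-1]) (zs i) =
             aw_eig a b c d q n * r.[zs i + (zs i)^-1]) ->
  r = 0.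
Proof.
move=> gz zI ne srn E; apply/eqP/negPn/negP => r0.
have [s [_ Es Ds]] := awD_poly a0 (leqnn (size r)).
have Esr : s = aw_eig a b c d q n *: r.
  apply/eqP; rewrite -subr_eq0; apply/eqP; apply: poly_eq0_inj zI _ => i.
  by rewrite hornerD hornerN hornerZ -Ds// E subrr.
have r1 : (0 < size r)%N by rewrite size_poly_gt0.
move: Es; rewrite Esr coefZ -lead_coefE => /mulIf; rewrite lead_coef_eq0.
move=> /(_ r0)/esym/eqP; apply/negP/ne; rewrite -ltnS prednK//.
Qed.

End OperatorTheory.

(** * Functions given by polynomials, for extending identities in a parameter *)

Section PolyFun.
Set Implicit Arguments.
Unset Strict Implicit.
Variable F : fieldType.

Definition polyfun (f : F -> F) := exists P : {poly F}, forall x, f x = P.[x].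

Lemma polyfun_cst c : polyfun (fun=> c).
Proof. by exists c%:P => x; rewrite hornerC. Qed.

Lemma polyfun_id : polyfun id.
Proof. by exists 'X => x; rewrite hornerX. Qed.

Lemma polyfunN f : polyfun f -> polyfun (fun x => - f x).
Proof. by move=> [P fP]; exists (- P) => x; rewrite hornerN fP. Qed.

Lemma polyfunM f g : polyfun f -> polyfun g -> polyfun (fun x => f x * g x).
Proof. by move=> [P fP] [Q gQ]; exists (P * Q) => x; rewrite hornerM fP gQ. Qed.

Lemma polyfun_qpoch f q n : polyfun f -> polyfun (fun x => qpoch (f x) q n).
Proof.
move=> [P fP]; exists (\prod_(k < n) (1 - P * (q ^+ k)%:P)) => x.
by rewrite horner_prod /qpoch fP; apply: eq_bigr => k _; rewrite !hornerE.
Qed.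

(** The first parameter stays constant because of the factor [a ^- n]. *)
Lemma polyfun_askey_wilson_z n z a b c d q :
  polyfun b -> polyfun c -> polyfun d ->
  polyfun (fun x => askey_wilson_z n z a (b x) (c x) (d x) q).
Proof.
move=> pb pc pd.
have H k : polyfun (fun x =>
    aw_coef a (b x) (c x) (d x) q n k * aw_base a q k z).
  rewrite /aw_coef; repeat first
    [ exact: polyfun_cst | assumption | apply: polyfun_qpoch
    | apply: polyfunM ].
(* The polynomials for the separate [k] are gathered into one family by induction on the bound,
   without a choice principle. *)
have [P EP] : exists P : nat -> {poly F}, forall k x, (k < n.+1)%N ->
    aw_coef a (b x) (c x) (d x) q n k * aw_base a q k z = (P k).[x].
  elim: n.+1 => [|N [P EP]]; first by exists (fun=> 0).
  have [R ER] := H N; exists (fun k => if k == N then R else P k) => k x.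
  rewrite ltnS leq_eqVlt => /orP[/eqP-> | kN]; first by rewrite eqxx.
  by rewrite ltn_eqF// EP.
exists (\sum_(k < n.+1) P k) => x.
by rewrite askey_wilson_zE horner_sum; apply: eq_bigr => k _; rewrite EP.
Qed.

Lemma polyfun_eq f g (x : nat -> F) : polyfun f -> polyfun g -> injective x ->
  (forall i, f (x i) = g (x i)) -> f =1 g.
Proof.
move=> [P fP] [Q gQ] xI E y; rewrite fP gQ.
suff /eqP : P - Q = 0 by rewrite subr_eq0 => /eqP->.
by apply: poly_eq0_inj xI _ => i; rewrite hornerD hornerN -fP -gQ E subrr.
Qed.

End PolyFun.

(** * The quadratic transformation from base $p^2$ to base $p$ *)

Section Quadratic.
Set Implicit Arguments.
Unset Strict Implicit.
Variables (F : fieldType) (p h : F).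
Hypothesis p0 : p != 0.
Hypothesis p_nroot : forall k, p ^+ k.+1 != 1.
Hypothesis hp : h ^+ 2 = p.

Let pXI : injective (fun i => p ^+ i) := exprX_inj p0 p_nroot.

Let p20 : p ^+ 2 != 0.
Proof. by rewrite expf_neq0. Qed.

Let p2_nroot k : (p ^+ 2) ^+ k.+1 != 1.
Proof. by rewrite -exprM mulnS p_nroot. Qed.

Let pX_eq i j : (p ^+ i == p ^+ j) = (i == j).
Proof. by apply/eqP/eqP => [/pXI|->]. Qed.

Lemma aw_genericX i : aw_generic p (p ^+ i.+1).
Proof.
rewrite /aw_generic expf_neq0//= -!exprM -exprS -(expr0 p).
rewrite -[X in _ && (_ && (_ != X))]expr1 !pX_eq; lia.
Qed.

(** The exponents start at 2: $z=p$ violates $z^2\neq p^2$, and $z/p$ must remain a positive power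
    of $p$ to be generic in base $p$. *)
Lemma aw_generic2X i : aw_generic (p ^+ 2) (p ^+ i.+2).
Proof.
rewrite /aw_generic expf_neq0//= -!exprM -exprD -(expr0 p) !pX_eq; lia.
Qed.

(** With $x,y$ positive powers of $p$, the difference of the two values is $(x-y)(xy-1)/(xy)$, and
    $xy\neq1$. *)
Lemma joukowskyX_inj : injective (fun i => p ^+ i.+2 + (p ^+ i.+2)^-1).
Proof.
move=> i j /eqP; rewrite -subr_eq0.
have x0 := expf_neq0 i.+2 p0; have y0 := expf_neq0 j.+2 p0.
have -> : p ^+ i.+2 + (p ^+ i.+2)^-1 - (p ^+ j.+2 + (p ^+ j.+2)^-1) =
  (p ^+ i.+2 - p ^+ j.+2) * (p ^+ (i.+2 + j.+2) - p ^+ 0)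
    / (p ^+ i.+2 * p ^+ j.+2).
  rewrite exprD expr0; move: (p ^+ i.+2) (p ^+ j.+2) x0 y0 => x y x0 y0.
  by field; rewrite x0 y0.
rewrite mulf_eq0 invr_eq0 (negbTE (mulf_neq0 x0 y0)) orbF mulf_eq0.
by rewrite !subr_eq0 !pX_eq => /orP[] /eqP // [].
Qed.

Section FixedA.
Variable A : F.
Hypothesis A0 : A != 0.

Section FixedB.
Variable B : F.
Variable n : nat.

Let f z := askey_wilson_z n z h (- h) A (- B) p.
Let g z := askey_wilson_z n z A (A * p) (- B) (- (B * p)) (p ^+ 2).
Let E (z : F) := (1 - A * z) * (1 + B * z) / (1 - z ^+ 2).

Let generic_neq0 (q z : F) : aw_generic q z ->
  [/\ z != 0, 1 - z ^+ 2 != 0, 1 - q * z ^+ 2 != 0 & z ^+ 2 - q != 0].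
Proof.
by case/and4P => ? ? ? ?; split=> //; rewrite subr_eq0 // eq_sym.
Qed.

(** This constant sum allows passing between [awD], written with differences of [f], and the
    two-term operator with coefficients [E w] and [E w^-1]. *)
Let sumE w : aw_generic p w -> E w + E w^-1 = 1 + A * B.
Proof.
move=> /generic_neq0[w0 w1 w2 w3]; rewrite /E.
rewrite (_ : (1 - w^-1 ^+ 2) = - (1 - w ^+ 2) / w ^+ 2); last by field.
by field; rewrite w0 w1 oppr_eq0 w1.
Qed.

(** As $h^2=p$, the factors $(1-hw)(1+hw)$ cancel $1-pw^2$ and [awC] reduces to [E]. The eigenvalue
    is [aw_eig] in base [p] plus the constant $1+AB$. *)
Let diffeq1 w : aw_generic p w ->
  E w * f (p * w) + E w^-1 * f (w / p) = (p ^- n + A * B * p ^+ n) * f w.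
Proof.
move=> gw; have sE := sumE gw; have [w0 w1 w2 w3] := generic_neq0 gw.
have := aw_diffeq h (- h) A (- B) p0 p_nroot n gw; rewrite /awD -/(f _).
have -> : awC h (- h) A (- B) p w = E w.
  rewrite /awC /E (_ : (1 - h * w) * (1 - - h * w) = 1 - p * w ^+ 2).
    by field; rewrite w1 w2.
  by rewrite -hp; ring.
have -> : awC h (- h) A (- B) p w^-1 = E w^-1.
  rewrite /awC /E (_ : (1 - h * w^-1) * (1 - - h * w^-1) = 1 - p * w^-1 ^+ 2).
    rewrite (_ : (1 - w^-1 ^+ 2) = - (1 - w ^+ 2) / w ^+ 2); last by field.
    rewrite (_ : (1 - p * w^-1 ^+ 2) = (w ^+ 2 - p) / w ^+ 2); last by field.
    by field; rewrite ?w0 ?oppr_eq0 ?w1 ?w3.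
  by rewrite -hp; ring.
rewrite /f -/(f w) -/(f (p * w)) -/(f (w / p)) => D.
have -> : E w * f (p * w) + E w^-1 * f (w / p) =
  aw_eig h (- h) A (- B) p n * f w + (E w + E w^-1) * f w by rewrite -D; ring.
rewrite sE /aw_eig (_ : h * - h * A * - B = p * (A * B)); last first.
  by rewrite -hp; ring.
have := expf_neq0 n p0; move: (p ^+ n) (f w) => x y x0; field.
by rewrite x0 p0.
Qed.

(** The base $p^2$ coefficients factor as $E(z)E(pz)$ and $E(1/z)E(p/z)$. Hence the operator is the
    square of the two-term one minus $(1+AB)^2$, and its eigenvalue is
    $(p^{-n}+ABp^n)^2-(1+AB)^2$. *)
Let diffeq2 z : aw_generic p z -> aw_generic p (p * z) ->
    aw_generic p (z / p) -> aw_generic (p ^+ 2) z ->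
  awD A (A * p) (- B) (- (B * p)) (p ^+ 2) f z =
  aw_eig A (A * p) (- B) (- (B * p)) (p ^+ 2) n * f z.
Proof.
move=> g1 g2 g3 g4.
have [z0 z1 _ _] := generic_neq0 g1; have [_ u1 _ _] := generic_neq0 g2.
have [_ v1 _ _] := generic_neq0 g3; have [_ _ t1 t2] := generic_neq0 g4.
have S := sumE g1; have S2 := sumE g2; have S3 := sumE g3.
have D := diffeq1 g1; have D2 := diffeq1 g2; have D3 := diffeq1 g3.
have C1 : awC A (A * p) (- B) (- (B * p)) (p ^+ 2) z = E z * E (p * z).
  by rewrite /awC /E; field; rewrite z1 u1.
have C2 : awC A (A * p) (- B) (- (B * p)) (p ^+ 2) z^-1 =
    E z^-1 * E (z / p)^-1.
  rewrite /awC /E.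
  rewrite (_ : (1 - z^-1 ^+ 2) = - (1 - z ^+ 2) / z ^+ 2); last by field.
  rewrite (_ : (1 - p ^+ 2 * z^-1 ^+ 2) = (z ^+ 2 - p ^+ 2) / z ^+ 2);
    last by field.
  rewrite (_ : (1 - (z / p)^-1 ^+ 2) = (z ^+ 2 - p ^+ 2) / z ^+ 2); last first.
    by field; rewrite z0 p0.
  by field; rewrite ?z0 ?p0 ?oppr_eq0 ?z1 ?t2.
have pz : p * z / p = z by rewrite mulrC mulKf.
have zp : p * (z / p) = z by rewrite mulrC divfK.
rewrite pz in D2; rewrite zp in D3.
have -> : awD A (A * p) (- B) (- (B * p)) (p ^+ 2) f z =
  E z * (E (p * z) * f (p * (p * z)) + E (p * z)^-1 * f z
         - (E (p * z) + E (p * z)^-1) * f z) +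
  E z^-1 * (E (z / p) * f z + E (z / p)^-1 * f (z / p / p)
         - (E (z / p) + E (z / p)^-1) * f z).
  rewrite /awD C1 C2 (_ : p ^+ 2 * z = p * (p * z)); last by ring.
  rewrite (_ : z / p ^+ 2 = z / p / p); last by field.
  ring.
rewrite D2 D3 S2 S3.
transitivity ((p ^- n + A * B * p ^+ n) * (E z * f (p * z) + E z^-1 * f (z / p))
  - (1 + A * B) * ((E z + E z^-1) * f z)); first by ring.
rewrite D S /aw_eig -!exprM mulnC exprM; have := expf_neq0 n p0.
move: (p ^+ n) (f z) => x y x0; field; by rewrite x0 p0.
Qed.

(** The assumption on $AB$ serves twice: it separates the eigenvalues in base $p^2$ and makes the
    leading coefficient of [P] nonzero. The factor $(-ABp^n;p)_n$ is the quotient of the leading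
    coefficients of [G] and [P]. *)
Lemma aw_quadratic_generic :
  (forall k, (k < n)%N -> (A * B * p ^+ (n + k)) ^+ 2 != 1) ->
  forall z, z != 0 -> g z = qpoch (- (A * B * p ^+ n)) p n * f z.
Proof.
move=> gAB z z0.
pose G := aw_poly A (A * p) (- B) (- (B * p)) (p ^+ 2) n.
pose P := aw_poly h (- h) A (- B) p n.
have h0 : h != 0 by apply: contra_neq p0 => h0; rewrite -hp h0 expr0n.
have lG : G`_n = qpoch (A * B * p ^+ n) p n * qpoch (- (A * B * p ^+ n)) p n.
  rewrite /G lead_aw_poly// -qpoch_sqr; congr qpoch.
  by rewrite -exprM mulnC exprM; field.
have lP : P`_n = qpoch (A * B * p ^+ n) p n.
  rewrite /P lead_aw_poly//; congr qpoch.
  rewrite (_ : h * - h * A * - B = p * (A * B)); last by rewrite -hp; ring.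
  by field.
have lP0 : P`_n != 0.
  rewrite lP; apply/prodf_neq0 => i _; rewrite -mulrA -exprD subr_eq0.
  apply: contra_neq (gAB i (ltn_ord i)) => <-; by rewrite expr1n.
(* The terms of degree [n] cancel in this combination, so the uniqueness lemma applies to it. *)
pose r := P`_n *: G - G`_n *: P.
suff r0 : r = 0.
  have : r.[z + z^-1] = 0 by rewrite r0 horner0.
  rewrite hornerD hornerN !hornerZ !(horner_aw_poly _ _ _ _ _ _ z0).
  rewrite -/(f z) -/(g z).
  move/eqP; rewrite subr_eq0 lG -lP -(mulrA P`_n) (inj_eq (mulfI lP0)).
  by move/eqP.
apply: (@awD_eigen_unique _ A (A * p) (- B) (- (B * p)) (p ^+ 2) p20 A0
          (fun i => p ^+ i.+2) n).
- exact: aw_generic2X.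
- exact: joukowskyX_inj.
- move=> k kn; rewrite -subr_eq0 aw_eigB// mulf_neq0//.
    rewrite subr_eq0 (inj_eq invr_inj) -!exprM pX_eq; lia.
  rewrite subr_eq0 eq_sym (_ : _ / _ = (A * B * p ^+ (n + k)) ^+ 2) ?gAB//.
  rewrite exprD -!(exprM p 2) ![(2 * _)%N]mulnC !exprM.
  by move: (p ^+ n) (p ^+ k) => x y; field.
- apply/leq_sizeP => j; rewrite leq_eqVlt => /predU1P[<- | nj].
    by rewrite coefB !coefZ mulrC subrr.
  have cj a' b' c' d' q : (aw_poly a' b' c' d' q n : {poly F})`_j = 0.
    by rewrite nth_default// (leq_trans (size_aw_poly _ _ _ _ _ _)).
  by rewrite coefB !coefZ !cj !mulr0 subrr.
- move=> i; set w := p ^+ i.+2.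
  have w0 : w != 0 by rewrite expf_neq0.
  have gw := aw_generic2X i.
  have Df : awD A (A * p) (- B) (- (B * p)) (p ^+ 2) f w =
    aw_eig A (A * p) (- B) (- (B * p)) (p ^+ 2) n * f w.
    apply: diffeq2 => //; rewrite /w; first exact: aw_genericX.
      by rewrite -exprS; exact: aw_genericX.
    by rewrite exprSr mulfK//; exact: aw_genericX.
  have Dg := aw_diffeq A (A * p) (- B) (- (B * p)) p20 p2_nroot n gw.
  rewrite -/w -/(g w) in Dg.
  have Er u : u != 0 -> r.[u + u^-1] = P`_n * g u - G`_n * f u.
    by move=> u0; rewrite /r hornerD hornerN !hornerZ !horner_aw_poly.
  rewrite (@eq_awD _ _ _ _ _ _ p20 _ _ w w0 Er) Er//.
  rewrite mulrBr mulrCA -Dg [X in _ - X]mulrCA -Df /awD -/(g _) /=.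
  rewrite /g; ring.
Qed.

End FixedB.

(* Singh's quadratic transformation. *)
Lemma aw_quadratic n z B : z != 0 ->
  askey_wilson_z n z A (A * p) (- B) (- (B * p)) (p ^+ 2) =
  qpoch (- (A * B * p ^+ n)) p n * askey_wilson_z n z h (- h) A (- B) p.
Proof.
move=> z0; move: B.
(* At B = p^(i+1)/A the eigenvalues in degrees at most n are distinct. *)
apply: (@polyfun_eq _ _ _ (fun i => p ^+ i.+1 / A)).
- by apply: polyfun_askey_wilson_z; repeat first [exact: polyfun_id |
    exact: polyfun_cst | apply: polyfunM | apply: polyfunN].
- apply: polyfunM; last apply: polyfun_askey_wilson_z; repeat first
    [exact: polyfun_id | exact: polyfun_cst | apply: polyfun_qpoch |
     apply: polyfunM | apply: polyfunN].
- by move=> i j /(mulIf _); rewrite invr_eq0 => /(_ A0)/pXI[].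
- move=> i; apply: aw_quadratic_generic => // k kn.
  by rewrite mulrCA divff// mulr1 -exprD -exprM addSn mulSn p_nroot.
Qed.

End FixedA.
End Quadratic.

(** * Exchange of degree and spectral index *)

Section Duality.
Set Implicit Arguments.
Unset Strict Implicit.
Variable F : fieldType.

(** Both sides equal $(x;q)_k(xq^k;q)_{m-k}(xq^k;q)_{n-k}$. *)
Lemma qpoch_exchange (x q : F) k m n : (k <= m)%N -> (k <= n)%N ->
  qpoch (x * q ^+ k) q (n - k) * qpoch x q m =
  qpoch (x * q ^+ k) q (m - k) * qpoch x q n.
Proof.
move=> km kn; rewrite -{1}(subnKC km) -{2}(subnKC kn) !qpochD; ring.
Qed.

(** At $z=aq^m$ the entry $a/z$ is $q^{-m}$, the partner of $q^{-n}$, and $az=a^2q^m$ is the partner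
    of $q^{n-1}abcd=a'^2q^n$. The two series therefore agree term by term up to the factors
    $(ab,ac,ad;q)$, which the outer products balance. *)
Lemma aw_duality (q a b c d a' b' c' d' : F) m n :
  q != 0 -> a != 0 -> a' != 0 ->
  a' * b' = a * b -> a' * c' = a * c -> a' * d' = a * d ->
  q * a' ^+ 2 = a * b * c * d ->
  a ^+ n * askey_wilson_z n (a * q ^+ m) a b c d q *
    qpochs [:: a * b; a * c; a * d] q m =
  a' ^+ m * askey_wilson_z m (a' * q ^+ n) a' b' c' d' q *
    qpochs [:: a * b; a * c; a * d] q n.
Proof.
move=> q0 a0 a'0 Eb Ec Ed Eq.
rewrite !askey_wilson_zE !qpochsE.
(* The common summand: exchanging [N] and [M] alters only the last three groups, which
   [qpoch_exchange] identifies. *)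
pose t N M k := qpoch (q ^- n) q k * qpoch (q ^- m) q k
  * qpoch (a' ^+ 2 * q ^+ n) q k * qpoch (a ^+ 2 * q ^+ m) q k / qpoch q q k
  * q ^+ k * (qpoch (a * b * q ^+ k) q (N - k) * qpoch (a * b) q M)
  * (qpoch (a * c * q ^+ k) q (N - k) * qpoch (a * c) q M)
  * (qpoch (a * d * q ^+ k) q (N - k) * qpoch (a * d) q M).
(* The parameter relations are symmetric: the dual of $qa'^2=abcd$ also holds. *)
have E' : a' * b' * c' * d' = q * a ^+ 2.
  have a'2 : a' ^+ 2 != 0 by rewrite expf_neq0.
  apply: (mulfI a'2); transitivity ((a' * b') * (a' * c') * (a' * d')).
    ring.
  rewrite Eb Ec Ed; transitivity (a ^+ 2 * (a * b * c * d)); first by ring.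
  rewrite -Eq; ring.
have tE N M k : (minn n m < k)%N -> t N M k = 0.
  rewrite gtn_min => /orP[] H; rewrite /t (qpochVX_eq0 q0 H).
    by rewrite !mul0r.
  by rewrite mulr0 !mul0r.
(* Terms beyond [minn n m] contain a vanishing $(q^{-n};q)_k$ or $(q^{-m};q)_k$, so both sums can be
   cut to the same range. *)
have cut N M : (minn n m <= N)%N ->
    \sum_(k < N.+1) t N M k = \sum_(k < (minn n m).+1) t N M k.
  move=> H; rewrite (@big_ord_widen _ _ _ (minn n m).+1 N.+1 (t N M)) ?ltnS//.
  rewrite [RHS]big_mkcond.
  by apply: eq_bigr => k _; case: ltnP => // /tE.
have -> : a ^+ n *
     (\sum_(k < n.+1) aw_coef a b c d q n k * aw_base a q k (a * q ^+ m))
   * (qpoch (a * b) q m * (qpoch (a * c) q m * qpoch (a * d) q m))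
   = \sum_(k < n.+1) t n m k.
  rewrite mulr_sumr mulr_suml; apply: eq_bigr => k _.
  rewrite /aw_coef /aw_base /t exprz_subr1// -Eq.
  have -> : q ^+ n / q * (q * a' ^+ 2) = a' ^+ 2 * q ^+ n by field.
  have -> : a * (a * q ^+ m)^-1 = q ^- m by field; rewrite a0 expf_neq0.
  rewrite (mulrA a a) -(expr2 a).
  rewrite -[RHS]mul1r -(mulfV (expf_neq0 n a0)); ring.
have -> : a' ^+ m *
     (\sum_(k < m.+1) aw_coef a' b' c' d' q m k * aw_base a' q k (a' * q ^+ n))
   * (qpoch (a * b) q n * (qpoch (a * c) q n * qpoch (a * d) q n))
   = \sum_(k < m.+1) t m n k.
  rewrite mulr_sumr mulr_suml; apply: eq_bigr => k _.
  rewrite /aw_coef /aw_base /t exprz_subr1// E' Eb Ec Ed.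
  have -> : q ^+ m / q * (q * a ^+ 2) = a ^+ 2 * q ^+ m by field.
  have -> : a' * (a' * q ^+ n)^-1 = q ^- n by field; rewrite a'0 expf_neq0.
  rewrite (mulrA a' a') -(expr2 a').
  rewrite -[RHS]mul1r -(mulfV (expf_neq0 m a'0)); ring.
rewrite !cut ?geq_minl ?geq_minr//; apply: eq_bigr => k _.
have [kn km] : (k <= n)%N /\ (k <= m)%N.
  by apply/andP; rewrite -leq_min -ltnS.
by rewrite /t !(qpoch_exchange _ _ km kn).
Qed.

End Duality.

(** * Both equalities for the $q$-Jacobi parameters, with the sign *)

Section QJacobi.
Set Implicit Arguments.
Unset Strict Implicit.
Variables (F : fieldType) (p u A B eps : F).
Hypothesis p0 : p != 0.
Hypothesis p_nroot : forall k, p ^+ k.+1 != 1.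
Hypothesis up : u ^+ 2 = p.
Hypothesis A0 : A != 0.
Hypothesis heps : eps = 1 \/ eps = -1.

Let u0 : u != 0.
Proof. by apply: contra_neq p0 => u0; rewrite -up u0 expr0n. Qed.

Let eps2 : eps ^+ 2 = 1.
Proof. by case: heps => ->; rewrite ?sqrrN expr1n. Qed.

(** Negating all four parameters preserves their pairwise products and turns $az$ into $-az$; only
    $a^{-n}$ contributes a sign. *)
Lemma askey_wilson_zN n (z a b c d q : F) :
  askey_wilson_z n (- z) a b c d q =
  (-1) ^+ n * askey_wilson_z n z (- a) (- b) (- c) (- d) q.
Proof.
rewrite /askey_wilson_z [RHS]mulrA (exprNn a) invfM [X in _ = X * _]mulrA.
rewrite mulfV ?signr_eq0// mul1r; congr (_ * _); apply: eq_bigr => k _.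
by rewrite invrN !(mulrN, mulNr, opprK).
Qed.

(** The lower sign uses the other square root $-u$ of $p$, followed by the parity
    [askey_wilson_zN]. *)
Lemma aw_quadratic_sign n z : z != 0 ->
  askey_wilson_z n (eps * z) A (A * p) (- B) (- (B * p)) (p ^+ 2) =
  eps ^+ n * qpoch (- (A * B * p ^+ n)) p n *
  askey_wilson_z n z u (- u) (eps * A) (- eps * B) p.
Proof.
move=> z0; case: heps => ->.
  by rewrite !mul1r expr1n mul1r mulN1r (aw_quadratic p0 p_nroot up).
have mup : (- u) ^+ 2 = p by rewrite sqrrN.
rewrite !mulN1r opprK mul1r (aw_quadratic p0 p_nroot mup A0) ?oppr_eq0//.
by rewrite askey_wilson_zN !opprK; ring.
Qed.

(** The denominators match because $(p^2;p^2)_n=(p,-p;p)_n$ and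
    $(-AB,-ABp;p^2)_n=(-AB;p)_{2n}=(-AB,-ABp^n;p)_n$; the last factor cancels the one from the
    quadratic transformation. *)
Lemma q_jacobi_quadratic n z : z != 0 ->
  qpochs [:: p ^+ 2; - (A * B); - (A * B * p)] (p ^+ 2) n != 0 ->
  A ^+ n / qpochs [:: p ^+ 2; - (A * B); - (A * B * p)] (p ^+ 2) n *
    askey_wilson_z n (eps * z) A (A * p) (- B) (- (B * p)) (p ^+ 2) =
  (eps * A) ^+ n / qpochs [:: p; - p; - (A * B)] p n *
    askey_wilson_z n z u (- u) (eps * A) (- eps * B) p.
Proof.
move=> z0; rewrite aw_quadratic_sign// !qpochsE qpoch_sqr.
rewrite -(mulNr (A * B) p) -qpoch_double qpochD !mulNr exprMn
   !mulf_eq0 !negb_or.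
case/andP => /andP[] ? ? /andP[] ? ?; field; exact/and4P.
Qed.

(** This is [aw_duality] with $a=u$ and $a'=w$; the other dual parameters are forced by $a'b'=ab$,
    $a'c'=ac$, $a'd'=ad$. *)
Lemma q_jacobi_duality m n w :
  w != 0 -> w ^+ 2 = A * B -> qpoch (- p) p n != 0 ->
  qpochs [:: - p; eps * (A * u); - eps * (B * u)] p m != 0 ->
  (eps * A) ^+ n / qpochs [:: p; - p; - (A * B)] p n *
    askey_wilson_z n (u * p ^+ m) u (- u) (eps * A) (- eps * B) p =
  (eps * (A / u)) ^+ n * w ^+ m *
  qpochs [:: eps * (A * u); - eps * (B * u)] p n /
  (qpochs [:: p; - (A * B)] p n *
   qpochs [:: - p; eps * (A * u); - eps * (B * u)] p m) *
  askey_wilson_z m (w * p ^+ n) w (- (p / w)) (eps * (A * u / w))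
    (- eps * (B * u / w)) p.
Proof.
move=> w0 w2 P0 D0.
have E : p * w ^+ 2 = u * - u * (eps * A) * (- eps * B).
  by rewrite w2 -up -[LHS]mulr1 -eps2; ring.
have Eb : w * - (p / w) = u * - u by rewrite -up; field.
have Ec : w * (eps * (A * u / w)) = u * (eps * A) by field.
have Ed : w * (- eps * (B * u / w)) = u * (- eps * B) by field.
have := aw_duality m n p0 u0 w0 Eb Ec Ed E.
rewrite (_ : u * - u = - p); last by rewrite -up; ring.
rewrite (_ : u * (eps * A) = eps * (A * u)); last by ring.
rewrite (_ : u * (- eps * B) = - eps * (B * u)); last by ring.
move: D0; rewrite !qpochsE.
set X := askey_wilson_z n _ _ _ _ _ _; set Y := askey_wilson_z m _ _ _ _ _ _.
move=> D0 XY.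
have un0 := expf_neq0 n u0.
have -> : X = w ^+ m * Y *
    (qpoch (- p) p n *
     (qpoch (eps * (A * u)) p n * qpoch (- eps * (B * u)) p n)) /
    (u ^+ n * (qpoch (- p) p m *
     (qpoch (eps * (A * u)) p m * qpoch (- eps * (B * u)) p m))).
  by apply: (canRL (mulfK (mulf_neq0 un0 D0))); rewrite -XY mulrCA mulrA.
rewrite (mulrA eps A u^-1) [(_ / u) ^+ n]exprMn exprVn !invfM.
rewrite -[RHS]mul1r -(divff P0); ring.
Qed.
End QJacobi.

(** * Laws of exponents for complex powers *)

Section ComplexPower.
Set Implicit Arguments.
Unset Strict Implicit.
Variable R : realType.
Implicit Types s t logq : R[i].

Lemma cexpD s t : cexp (s + t) = cexp s * cexp t.
Proof.
case: s t => [a b] [c d]; rewrite /cexp /= expRD cosD sinD.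
by apply/eqP; rewrite eq_complex /=; apply/andP; split; apply/eqP; ring.
Qed.

Lemma cexp0 : cexp (0 : R[i]) = 1.
Proof. by rewrite /cexp /= expR0 cos0 sin0 mulr1 mulr0. Qed.

Lemma cpowD logq s t : cpow logq (s + t) = cpow logq s * cpow logq t.
Proof. by rewrite /cpow mulrDl cexpD. Qed.

Lemma cpow0 logq : cpow logq 0 = 1.
Proof. by rewrite /cpow mul0r cexp0. Qed.

Lemma cpow_neq0 logq s : cpow logq s != 0.
Proof.
have : cpow logq s * cpow logq (- s) != 0.
  by rewrite -cpowD subrr cpow0 oner_eq0.
by rewrite mulf_eq0 negb_or => /andP[].
Qed.

Lemma cpowN logq s : cpow logq (- s) = (cpow logq s)^-1.
Proof.
apply: (mulfI (cpow_neq0 logq s)).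
by rewrite -cpowD subrr cpow0 divff ?cpow_neq0.
Qed.

Lemma cpowMn logq s n : cpow logq (s * n%:R) = cpow logq s ^+ n.
Proof.
elim: n => [|n IH]; first by rewrite mulr0 cpow0.
by rewrite -addn1 natrD mulrDr mulr1 cpowD IH exprD.
Qed.

End ComplexPower.

(* [eps] is the sign: 1 for the upper signs, -1 for the lower ones. *)
Theorem theorem2p6 (R : realType) (m n : nat) (q logq alpha beta eps : R[i])
  (hq0 : q != 0) (hq1 : `|q| != 1) (hlog : cexp logq = q)
  (heps : eps = 1 \/ eps = -1)
  (hden1 : q_jacobi_den n alpha beta q logq != 0)
  (hden2 : qpochs [:: cpow logq (1 / 2); - cpow logq (1 / 2);
                      - cpow logq ((alpha + beta + 1) / 2)]
                  (cpow logq (1 / 2)) n != 0)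
  (hden3 : qpochs [:: cpow logq (1 / 2);
                      - cpow logq ((alpha + beta + 1) / 2)]
                  (cpow logq (1 / 2)) n
         * qpochs [:: - cpow logq (1 / 2);
                      eps * cpow logq ((alpha + 1) / 2);
                      - eps * cpow logq ((beta + 1) / 2)]
                  (cpow logq (1 / 2)) m != 0) :
  let Q := cpow logq in
  let qh := Q (1 / 2) in
  let x (s : R[i]) := s * ((Q (1 / 4 + m%:R / 2)
                          + Q (- (1 / 4) - m%:R / 2)) / 2) in
  let middle :=
    (eps * Q (alpha / 2 + 1 / 4)) ^+ n
    / qpochs [:: qh; - qh; - Q ((alpha + beta + 1) / 2)] qh n
    * askey_wilson n (x 1)
        (Q (1 / 4)) (- Q (1 / 4))
        (eps * Q (alpha / 2 + 1 / 4))
        (- eps * Q (beta / 2 + 1 / 4)) qh in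
  q_jacobi n alpha beta (x eps) q logq = middle
  /\
  middle =
    (eps * Q (alpha / 2)) ^+ n
    * Q ((alpha + beta + 1) / 4) ^+ m
    * qpochs [:: eps * Q ((alpha + 1) / 2);
                 - eps * Q ((beta + 1) / 2)] qh n
    / (qpochs [:: qh; - Q ((alpha + beta + 1) / 2)] qh n
       * qpochs [:: - qh; eps * Q ((alpha + 1) / 2);
                    - eps * Q ((beta + 1) / 2)] qh m)
    * askey_wilson m
        ((Q ((alpha + beta + 1 + 2 * n%:R) / 4)
          + Q (- ((alpha + beta + 1 + 2 * n%:R) / 4))) / 2)
        (Q ((alpha + beta + 1) / 4))
        (- Q ((- alpha - beta + 1) / 4))
        (eps * Q ((alpha - beta + 1) / 4))
        (- eps * Q ((beta - alpha + 1) / 4)) qh.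
Proof.
move=> Q qh x middle; rewrite {}/middle.
(* All powers of $q$ in the statement become monomials in $u,A,B,w$ and $q^{1/2}$, with
   $u^2=q^{1/2}$ and $w^2=AB$. *)
pose u := Q (1 / 4); pose A := Q (alpha / 2 + 1 / 4).
pose B := Q (beta / 2 + 1 / 4); pose w := Q ((alpha + beta + 1) / 4).
have Q0 s : Q s != 0 := cpow_neq0 logq s.
have QN s : Q (- s) = (Q s)^-1 := cpowN logq s.
have split3 s t r : s = t + r -> Q s = Q t * Q r.
  by move=> ->; rewrite /Q cpowD.
have up : u ^+ 2 = qh by rewrite expr2 -(@split3 (1 / 2))//; field.
have qE : q = qh ^+ 2.
  rewrite expr2 -(@split3 1); last by field.
  by rewrite /Q /cpow mul1r.
(* A root of unity $q^{1/2}$ would give $|q|^{k+1}=1$, hence $|q|=1$. *)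
have qh_nroot k : qh ^+ k.+1 != 1.
  apply: contra_neq hq1 => E; apply/eqP; rewrite -(@pexpr_eq1 _ _ k.+1)//.
  by rewrite -normrX qE -exprM mulnC exprM E expr1n normr1.
have EAp : Q (alpha / 2 + 3 / 4) = A * qh by apply: split3; field.
have EBp : Q (beta / 2 + 3 / 4) = B * qh by apply: split3; field.
have EAB : Q ((alpha + beta + 1) / 2) = A * B by apply: split3; field.
have EABp : Q ((alpha + beta + 2) / 2) = A * B * qh.
  by rewrite -EAB; apply: split3; field.
have EAu : Q ((alpha + 1) / 2) = A * u by apply: split3; field.
have EBu : Q ((beta + 1) / 2) = B * u by apply: split3; field.
have EA : Q (alpha / 2) = A / u.
  by apply: (mulIf (Q0 (1 / 4))); rewrite mulfVK ?Q0// -cpowD.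
have w2 : w ^+ 2 = A * B.
  by rewrite -EAB expr2; symmetry; apply: split3; field.
have Eb : Q ((- alpha - beta + 1) / 4) = qh / w.
  by apply: (mulIf (Q0 ((alpha + beta + 1) / 4))); rewrite mulfVK ?Q0//
    -cpowD; congr cpow; field.
have Ec : Q ((alpha - beta + 1) / 4) = A * u / w.
  by apply: (mulIf (Q0 ((alpha + beta + 1) / 4))); rewrite mulfVK ?Q0//
    -!cpowD; congr cpow; field.
have Ed : Q ((beta - alpha + 1) / 4) = B * u / w.
  by apply: (mulIf (Q0 ((alpha + beta + 1) / 4))); rewrite mulfVK ?Q0//
    -!cpowD; congr cpow; field.
have Ez : Q (1 / 4 + m%:R / 2) = u * qh ^+ m.
  by rewrite -[qh ^+ m]cpowMn; apply: split3; field.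
have Et : Q ((alpha + beta + 1 + 2 * n%:R) / 4) = w * qh ^+ n.
  by rewrite -[qh ^+ n]cpowMn; apply: split3; field.
have EAn : Q ((alpha / 2 + 1 / 4) * n%:R) = A ^+ n by rewrite -cpowMn.
have z0 : u * qh ^+ m != 0 := mulf_neq0 (Q0 _) (expf_neq0 _ (Q0 _)).
have eps0 : eps != 0 by case: heps => ->; rewrite ?oppr_eq0 oner_eq0.
(* Since $s^{-1}=s$, the sign moves into $z$, and $x_m^{\pm}$ is the Joukowsky image of $\pm
   q^{1/4+m/2}$. *)
have xE s : s = 1 \/ s = -1 ->
    x s = (s * (u * qh ^+ m) + (s * (u * qh ^+ m))^-1) / 2.
  move=> hs; have sV : s^-1 = s by case: hs => ->; rewrite ?invrN invr1.
  by rewrite /x -opprD QN Ez (invfM s) sV; ring.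
rewrite (xE 1); last by left.
rewrite (mul1r (u * _)) askey_wilsonE// QN Et askey_wilsonE; last first.
  exact: mulf_neq0 (Q0 _) (expf_neq0 _ (Q0 _)).
rewrite /q_jacobi (xE _ heps) askey_wilsonE; last by rewrite mulf_neq0.
move: hden1 hden2 hden3; rewrite /q_jacobi_den -/Q -/qh.
rewrite EAp EBp EAB EABp EAu EBu EA Eb Ec Ed EAn -/A -/B -/u -/w qE.
move=> hden1 hden2; rewrite mulf_eq0 negb_or => /andP[_ hden3].
have P0 : qpoch (- qh) qh n != 0.
  by move: hden2; rewrite !qpochsE !mulf_eq0 !negb_or => /and3P[].
split.
  exact: (q_jacobi_quadratic (Q0 _) qh_nroot up (Q0 _) heps z0 hden1).
exact: (q_jacobi_duality (Q0 _) up heps (Q0 _) w2 P0 hden3).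
Qed.
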